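(* Let $\tilde\gamma,\tilde\delta,L_K>0$ and $\kappa_F:=L_K^2/(\tilde\gamma\tilde\delta)$. Call $(\tau,\sigma,\theta,\omega)$ admissible if $\tau>0$, $\sigma>0$, $0<\theta\le1$, $$\max\left\{\frac{1}{\tau\tilde\gamma+1},\frac{1}{\sigma\tilde\delta+1}\right\}\le\theta\le\frac{1}{L_K^2\tau\sigma}\qquad\text{and}\qquad \max\left\{\frac{1}{\tau\tilde\gamma+1},\frac{\theta+1}{\sigma\tilde\delta+2}\right\}\le\omega\le\theta .$$ Then the smallest value of $\omega$ over all admissible quadruples (the best convergence rate) is attained with $$\tau=\frac{\tilde\delta}{2L_K^2}\left(1+\sqrt{1+\frac{4L_K^2}{\tilde\gamma\tilde\delta}}\right),\qquad \sigma=\frac{\tilde\gamma}{2L_K^2}\left(1+\sqrt{1+\frac{4L_K^2}{\tilde\gamma\tilde\delta}}\right),\qquad \theta=\frac{\sqrt{1+4\kappa_F}-1}{\sqrt{1+4\kappa_F}+1}<1,$$ which satisfy $\tau\tilde\gamma=\sigma\tilde\delta$, and this smallest value is $\omega^*=\theta=\dfrac{\sqrt{1+4\kappa_F}-1}{\sqrt{1+4\kappa_F}+1}$.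
   Context: The constraints are the parameter conditions under which the overrelaxed primal-dual hybrid gradient algorithm $y_{n+1}=\mathrm{prox}_{\sigma H^*}(y_n+\sigma K\bar\xi_n)$, $\xi_{n+1}=\mathrm{prox}_{\tau G}(\xi_n-\tau K^*y_{n+1})$, $\bar\xi_{n+1}=\xi_{n+1}+\theta(\xi_{n+1}-\xi_n)$ converges linearly with rate $\omega$, where $G$ is $\tilde\gamma$-strongly convex, $H^*$ is $\tilde\delta$-strongly convex and $\|K\|=L_K$. The claim concerns only the minimization of $\omega$ over the parameters. *)

(* Defs.v *)
From HB Require Import structures.
From mathcomp Require Import all_boot all_order all_algebra.
From mathcomp Require Import reals.

Set Implicit Arguments.
Unset Strict Implicit.
Unset Printing Implicit Defensive.

Import Order.TTheory GRing.Theory Num.Theory.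
Local Open Scope ring_scope.

(* gamma and delta are the strong convexity moduli of G and H^*, L is the
   operator norm of K. *)
Definition kappaF (R : realType) (gamma delta L : R) : R :=
  L ^+ 2 / (gamma * delta).

Definition admissible (R : realType) (gamma delta L : R)
    (tau sigma theta omega : R) : Prop :=
  [/\ 0 < tau,
      0 < sigma,
      0 < theta <= 1,
      Num.max (1 / (tau * gamma + 1)) (1 / (sigma * delta + 1)) <= theta
        <= 1 / (L ^+ 2 * tau * sigma) &
      Num.max (1 / (tau * gamma + 1)) ((theta + 1) / (sigma * delta + 2))
        <= omega <= theta].

Definition tau_opt (R : realType) (gamma delta L : R) : R :=
  delta / (2 * L ^+ 2) * (1 + Num.sqrt (1 + 4 * L ^+ 2 / (gamma * delta))).

Definition sigma_opt (R : realType) (gamma delta L : R) : R :=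
  gamma / (2 * L ^+ 2) * (1 + Num.sqrt (1 + 4 * L ^+ 2 / (gamma * delta))).

Definition theta_opt (R : realType) (gamma delta L : R) : R :=
  (Num.sqrt (1 + 4 * kappaF gamma delta L) - 1)
    / (Num.sqrt (1 + 4 * kappaF gamma delta L) + 1).

(* Main.v *)
Require Import Defs.
From HB Require Import structures.
From mathcomp Require Import all_boot all_order all_algebra.
From mathcomp Require Import reals.
From mathcomp Require Import ring lra.

Set Implicit Arguments.
Unset Strict Implicit.
Unset Printing Implicit Defensive.

Import Order.TTheory GRing.Theory Num.Theory.
Local Open Scope ring_scope.

(** With a = tau gamma, b = sigma delta and kappa = L^2 / (gamma delta), an
    admissible quadruple has a >= (1 - omega) / omega,
    b >= (1 + theta - 2 omega) / omega >= (1 - omega) / omega and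
    kappa theta a b <= 1, whence kappa (1 - omega)^2 <= omega.  Writing
    s = sqrt (1 + 4 kappa), so that kappa = (s^2 - 1) / 4, the value
    (s - 1) / (s + 1) turns this into an equality, and it is reached for
    a = b = 2 / (s - 1). *)

Lemma admissible_rate_bound (R : realType)
    (gamma delta L tau sigma theta omega : R) :
  0 < gamma -> 0 < delta -> 0 < L ->
  admissible gamma delta L tau sigma theta omega ->
  [/\ 0 < omega, omega <= 1 &
      kappaF gamma delta L * (1 - omega) ^+ 2 <= omega].
Proof.
move=> g0 d0 L0 [t0 s0 /andP[th0 th1]].
move=> /andP[_ thL]; rewrite ge_max => /andP[/andP[wa wb] wth].
have a0 : 0 < tau * gamma by apply: mulr_gt0.
have b0 : 0 < sigma * delta by apply: mulr_gt0.
have k0 : 0 < kappaF gamma delta L.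
  by rewrite /kappaF divr_gt0 ?exprn_gt0 ?mulr_gt0.
have w0 : 0 < omega.
  by apply: lt_le_trans wa; rewrite divr_gt0 // addr_gt0.
have w1 : omega <= 1 by apply: le_trans wth th1.
split=> //.
have kab : kappaF gamma delta L * (tau * gamma) * (sigma * delta)
    = L ^+ 2 * tau * sigma.
  by rewrite /kappaF; field; rewrite !gt_eqF.
have {}thL : theta * (kappaF gamma delta L * (tau * gamma) * (sigma * delta))
    <= 1.
  by rewrite kab -ler_pdivlMr // !mulr_gt0 ?exprn_gt0.
rewrite ler_pdivrMr ?addr_gt0 // in wa.
rewrite ler_pdivrMr ?addr_gt0 // in wb.
move: (kappaF gamma delta L) (tau * gamma) (sigma * delta)
  a0 b0 k0 wa wb thL {kab} => k a b a0 b0 k0 wa wb thL.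
have wa' : 1 - omega <= omega * a by lra.
(* Since [omega <= theta], [1 + theta - 2 * omega] is at least [1 - omega]. *)
have wb' : 1 - omega <= omega * b by lra.
have wab : (1 - omega) ^+ 2 <= omega * a * (omega * b).
  by rewrite expr2; apply: ler_pM => //; rewrite subr_ge0.
have kw : k * (1 - omega) ^+ 2 <= omega * (omega * (k * a * b)).
  rewrite [leRHS](_ : _ = k * (omega * a * (omega * b))); last by ring.
  by rewrite ler_pM2l.
(* Enlarging the inner [omega] to [theta] brings the bound under [thL]. *)
apply: (le_trans kw); rewrite -[leRHS]mulr1 ler_pM2l //.
apply: le_trans thL; rewrite ler_pM2r // !mulr_gt0 //.
Qed.

(** By contradiction: below the smaller root both linear factors of the quadratic are positive, the
    second because [w <= 1] keeps [w] below the larger root, whereas the hypothesis makes the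
    quadratic nonpositive. *)
Lemma rate_ge_of_sqr_bound (R : realFieldType) (s w : R) :
  1 < s -> 0 < w -> w <= 1 -> (s ^+ 2 - 1) / 4 * (1 - w) ^+ 2 <= w ->
  (s - 1) / (s + 1) <= w.
Proof.
move=> s1 w0 w1 h.
rewrite ler_pdivrMr; last by lra.
rewrite leNgt; apply/negP => hlt.
(* The quadratic [(s^2 - 1) (1 - w)^2 - 4 w] has roots
   [(s - 1) / (s + 1)] and [(s + 1) / (s - 1)]. *)
have : 0 < (s - 1 - w * (s + 1)) * (s + 1 - w * (s - 1)).
  apply: mulr_gt0; first by rewrite subr_gt0.
  have : w * (s - 1) <= 1 * (s - 1) by rewrite ler_pM2r //; lra.
  lra.
have -> : (s - 1 - w * (s + 1)) * (s + 1 - w * (s - 1))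
    = 4 * ((s ^+ 2 - 1) / 4 * (1 - w) ^+ 2 - w) by field.
lra.
Qed.

Theorem theorem2 (R : realType) (gamma delta L : R)
    (gamma_gt0 : 0 < gamma) (delta_gt0 : 0 < delta) (L_gt0 : 0 < L) :
  let tau := tau_opt gamma delta L in
  let sigma := sigma_opt gamma delta L in
  let theta := theta_opt gamma delta L in
  [/\ tau * gamma = sigma * delta,
      theta < 1,
      admissible gamma delta L tau sigma theta theta &
      forall tau' sigma' theta' omega' : R,
        admissible gamma delta L tau' sigma' theta' omega' ->
        theta <= omega'].
Proof.
have k0 : 0 < kappaF gamma delta L.
  by rewrite /kappaF divr_gt0 ?exprn_gt0 ?mulr_gt0.
(* Regrouping [4 * L ^+ 2 / (gamma * delta)] makes all the square roots coincide, so one [s] stands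
   for each of them. *)
rewrite /tau_opt /sigma_opt /theta_opt -[4 * L ^+ 2 / _]mulrA -/(kappaF _ _ _).
set s := Num.sqrt _; set tau := delta / _ * _; set sigma := gamma / _ * _.
set theta := _ / (s + 1).
have s2 : s ^+ 2 = 1 + 4 * kappaF gamma delta L by rewrite sqr_sqrtr //; lra.
have s1 : 1 < s by rewrite -[1]sqrtr1 ltr_sqrt; lra.
have kE : kappaF gamma delta L = (s ^+ 2 - 1) / 4 by rewrite s2; field.
have sm0 : s - 1 != 0 by rewrite gt_eqF // subr_gt0.
have sp0 : s + 1 != 0 by rewrite gt_eqF //; lra.
have g0 : gamma != 0 by rewrite gt_eqF.
have d0 : delta != 0 by rewrite gt_eqF.
(* Eliminating [L ^+ 2] turns the optimal parameters into rational functions of [s], [gamma] and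
   [delta], within reach of [field]. *)
have LE : L ^+ 2 = (s - 1) * (s + 1) / 4 * (gamma * delta).
  have -> : (s - 1) * (s + 1) / 4 = kappaF gamma delta L by rewrite kE; field.
  by rewrite /kappaF divfK // mulf_neq0.
have tE : tau = 2 / ((s - 1) * gamma).
  by rewrite /tau LE; field; rewrite g0 d0 sm0 sp0.
have sE : sigma = 2 / ((s - 1) * delta).
  by rewrite /sigma LE; field; rewrite g0 d0 sm0 sp0.
have aE : tau * gamma = 2 / (s - 1) by rewrite tE; field; rewrite g0 sm0.
have bE : sigma * delta = 2 / (s - 1) by rewrite sE; field; rewrite d0 sm0.
have th0 : 0 < theta by rewrite divr_gt0 //; lra.
have th1 : theta < 1 by rewrite ltr_pdivrMr; lra.
(* At the optimum every bound on [theta] and [omega] other than [theta <= 1] is tight: both entries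
   of each maximum and the upper limit all equal [theta]. *)
have h1 : 1 / (2 / (s - 1) + 1) = theta.
  by rewrite /theta; field; rewrite sm0 sp0.
have h2 : (theta + 1) / (2 / (s - 1) + 2) = theta.
  rewrite /theta; field; rewrite sm0 sp0 /=.
  by rewrite gt_eqF //; lra.
have h3 : 1 / (L ^+ 2 * tau * sigma) = theta.
  by rewrite LE tE sE /theta; field; rewrite g0 d0 sm0 sp0.
split=> //; first by rewrite aE bE.
- split; rewrite ?aE ?bE ?h1 ?h2 ?h3 ?maxxx ?lexx //.
  + by rewrite tE divr_gt0 // mulr_gt0 // subr_gt0.
  + by rewrite sE divr_gt0 // mulr_gt0 // subr_gt0.
  + by rewrite th0 ltW.
- move=> t' s' th' w' /(admissible_rate_bound gamma_gt0 delta_gt0 L_gt0).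
  by case=> w0 w1; rewrite kE; apply: rate_ge_of_sqr_bound.
Qed.
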